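(* Let $n\ge 3$ be an integer and let $\Theta\in\mathbb{R}$ be any subcritical phase, i.e. $|\Theta|<(n-1)\frac{\pi}{2}$. Then: (1) there exists a non-polynomial entire solution $u:\mathbb{C}^{n+1}\to\mathbb{R}$ of the dHYM/LYZ equation on $\mathbb{C}^{n+1}$ whose phase is identically $\Theta$; (2) there exists a non-polynomial entire solution $f:\mathbb{R}^{n+1}\to\mathbb{R}$ of the special Lagrangian equation on $\mathbb{R}^{n+1}$ whose phase is identically $\Theta$.
   Context: For a real-valued $C^2$ function $u$ on $\mathbb{C}^{n+1}$, let $\lambda_1,\dots,\lambda_{n+1}$ be the eigenvalues of the Hermitian matrix $\partial\bar\partial u=\bigl[\frac{\partial^2u}{\partial z_j\partial\bar z_k}\bigr]_{1\le j,k\le n+1}$; for a real-valued $C^2$ function $f$ on $\mathbb{R}^{n+1}$, let them be the eigenvalues of the Hessian matrix $\nabla^2 f=\bigl[\frac{\partial^2 f}{\partial x_j\partial x_k}\bigr]$. Let $\sigma_k$ be the $k$-th elementary symmetric polynomial of $\lambda_1,\dots,\lambda_{n+1}$. The dHYM/LYZ equation (for $u$), respectively the special Lagrangian equation (for $f$), is $$\cos\theta\,(\sigma_1-\sigma_3+\sigma_5-\cdots)-\sin\theta\,(1-\sigma_2+\sigma_4-\cdots)=0$$ for some constant $\theta\in\mathbb{R}$; equivalently $\operatorname{Im}\bigl(e^{-i\theta}\prod_{j=1}^{n+1}(1+i\lambda_j)\bigr)=0$. The phase of $u$ (resp. $f$) is the function $\sum_{j=1}^{n+1}\arctan\lambda_j$;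 for a solution it is a constant congruent to $\theta$ modulo $\pi\mathbb{Z}$. ''Entire'' means defined on the whole space; ''non-polynomial'' means not a polynomial in the real coordinates. *)

(* Defs.v *)
From HB Require Import structures.
From mathcomp Require Import all_boot all_order all_algebra.
From mathcomp Require Import complex.
From mathcomp Require Import all_classical all_reals all_analysis.
(* [mpoly] is not imported: its notations clash with those of MathComp-Analysis. *)
From mathcomp Require mpoly.

Set Implicit Arguments.
Unset Strict Implicit.
Unset Printing Implicit Defensive.

Import Order.TTheory GRing.Theory Num.Theory.
Import numFieldNormedType.Exports.

Local Open Scope ring_scope.
Local Open Scope complex_scope.

Section RealCoordinates.
Context {R : realType} {m : nat}.

Definition partial (j : 'I_m) (f : 'rV[R]_m -> R) (x : 'rV[R]_m) : R :=
  'D_(delta_mx 0 j) f x.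

Definition C1 (f : 'rV[R]_m -> R) : Prop :=
  [/\ continuous f,
      forall j x, derivable f x (delta_mx 0 j)
    & forall j, continuous (partial j f)].

Definition C2 (f : 'rV[R]_m -> R) : Prop :=
  C1 f /\ forall j, C1 (partial j f).

Definition polynomial_function (f : 'rV[R]_m -> R) : Prop :=
  exists p : mpoly.mpoly m R, forall x, f x = mpoly.meval (x 0) p.

Definition hessian (f : 'rV[R]_m -> R) (x : 'rV[R]_m) : 'M[R]_m :=
  \matrix_(j, k) partial j (partial k f) x.

End RealCoordinates.

Section ComplexCoordinates.
Context {R : realType} {m : nat}.

(* The identification of [R^(2m)] with [C^m]: the real coordinates of [z] are
   [x_0, ..., x_(m-1), y_0, ..., y_(m-1)], where [z_j = x_j + i y_j]. *)
Definition to_complex (p : 'rV[R]_(m + m)) : 'rV[R[i]]_m :=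
  \row_j (p 0 (lshift m j) +i* p 0 (rshift m j)).

Definition real_coords (z : 'rV[R[i]]_m) : 'rV[R]_(m + m) :=
  row_mx (map_mx (@complex.Re R) z) (map_mx (@complex.Im R) z).

Definition cpartial (l : 'I_(m + m)) (g : 'rV[R[i]]_m -> R[i])
    (z : 'rV[R[i]]_m) : R[i] :=
  partial l (fun p => complex.Re (g (to_complex p))) (real_coords z)
  +i* partial l (fun p => complex.Im (g (to_complex p))) (real_coords z).

Definition d_z (j : 'I_m) (g : 'rV[R[i]]_m -> R[i]) (z : 'rV[R[i]]_m) : R[i] :=
  2^-1 * (cpartial (lshift m j) g z - (0 +i* 1) * cpartial (rshift m j) g z).

Definition d_zbar (j : 'I_m) (g : 'rV[R[i]]_m -> R[i]) (z : 'rV[R[i]]_m) :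
    R[i] :=
  2^-1 * (cpartial (lshift m j) g z + (0 +i* 1) * cpartial (rshift m j) g z).

Definition complex_hessian (u : 'rV[R[i]]_m -> R) (z : 'rV[R[i]]_m) :
    'M[R[i]]_m :=
  \matrix_(j, k) d_z j (d_zbar k (fun w => (u w)%:C)) z.

End ComplexCoordinates.

Section Phase.
Context {R : realType}.

(* The roots of the characteristic polynomial, with multiplicity, in an
   unspecified order.  It is meant for Hermitian matrices, whose eigenvalues
   are real, so that taking real parts only changes their type. *)
Definition eigenvalues {m : nat} (A : 'M[R[i]]_m) : seq R :=
  [seq complex.Re l | l <- sval (closed_field_poly_normal (char_poly A))].

Definition elem_sym (k : nat) (s : seq R) : R :=
  mpoly.meval (tnth (in_tuple s)) (mpoly.mesym (size s) R k).

Definition phase_equation (theta : R) (s : seq R) : Prop :=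
  cos theta * (\sum_(k < (size s).+1 | odd k) (-1) ^+ k./2 * elem_sym k s)
  - sin theta * (\sum_(k < (size s).+1 | ~~ odd k) (-1) ^+ k./2 * elem_sym k s)
  = 0.

Definition phase (s : seq R) : R := \sum_(l <- s) atan l.

Definition complex_eigenvalues {m : nat} (u : 'rV[R[i]]_m -> R)
    (z : 'rV[R[i]]_m) : seq R :=
  eigenvalues (complex_hessian u z).

Definition real_eigenvalues {m : nat} (f : 'rV[R]_m -> R) (x : 'rV[R]_m) :
    seq R :=
  eigenvalues (map_mx (real_complex R) (hessian f x)).

Definition entire_dHYM_solution {m : nat} (u : 'rV[R[i]]_m -> R) : Prop :=
  C2 (u \o to_complex) /\
  exists theta : R, forall z, phase_equation theta (complex_eigenvalues u z).

Definition entire_special_Lagrangian_solution {m : nat} (f : 'rV[R]_m -> R) :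
    Prop :=
  C2 f /\
  exists theta : R, forall x, phase_equation theta (real_eigenvalues f x).

End Phase.

(* Main.v *)
Require Import Defs.
From HB Require Import structures.
From mathcomp Require Import all_boot all_order all_algebra.
From mathcomp Require Import complex.
From mathcomp Require Import all_classical all_reals all_analysis.
From mathcomp Require Import ring lra.

(* The function e^(x_a) cos x_b is harmonic in the plane (x_a, x_b), so its
   Hessian there has eigenvalues e^(x_a) and -e^(x_a), whose arctangents cancel.
   In R^(2+k), adding (c/2) x_j^2 for each of the k remaining coordinates
   contributes k atan c to the phase, which takes every value t with
   |t| < k pi / 2.  On C^m the same function, with x_a + i x_b = z_0, is the real
   part of e^(z_0); it is pluriharmonic and disappears from the complex Hessian,
   so that adding c |z|^2 gives the phase m atan c.  Neither function is a
   polynomial, since along the x_b axis cos would then be one, although it takes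
   the value 1 infinitely often.  Finally, a list of eigenvalues l with phase t
   satisfies the equation with theta = t because prod (1 + i l) is both a real
   multiple of e^(i t) and the sum of i^k sigma_k. *)

Import Order.TTheory GRing.Theory Num.Theory.
Import numFieldNormedType.Exports.

Local Open Scope ring_scope.
Local Open Scope complex_scope.

(** * Calculus and non-polynomiality of e^(x_a) cos x_b plus a quadratic *)

Section ExpCos.
Context {R : realType} {m : nat}.
Implicit Types (f : 'rV[R]_m -> R) (x v : 'rV[R]_m).

(** Both derivatives are limits of the same difference quotient, so the rules of one-variable
    calculus apply to functions on ['rV[R]_m]. *)
Lemma is_derive_line f x v df :
  is_derive (0 : R) (1 : R) (fun t => f (t *: v + x)) df -> is_derive x v f df.
Proof.
move=> [dg gE].
have E : (fun h : R => h^-1 *: ((fun t => f (t *: v + x)) (h *: 1 + 0)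
     - (fun t => f (t *: v + x)) 0)) = (fun h => h^-1 *: (f (h *: v + x) - f x)).
  by apply/funext => h /=; rewrite scale0r add0r addr0 [h *: 1]mulr1.
apply: DeriveDef.
  by move: dg; rewrite /derivable /= E.
by rewrite -gE /derive /= E.
Qed.

(* The parameters make the family stable under partial derivatives. *)
Definition expcos (a b : 'I_m) (p q : R) (d l : 'I_m -> R) (k : R) x : R :=
  expR (x 0 a) * (p * cos (x 0 b) + q * sin (x 0 b))
  + \sum_i (d i / 2 * x 0 i ^+ 2 + l i * x 0 i) + k.

(** The exponential keeps the pair [(p, q)], the trigonometric factor turns it into [(q, - p)];
    quadratic coefficients become linear and linear ones constant. *)
Lemma is_derive_expcos a b p q d l k j x :
  is_derive x (delta_mx 0 j) (expcos a b p q d l k)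
    (expcos a b (p * (a == j)%:R + q * (b == j)%:R)
       (q * (a == j)%:R - p * (b == j)%:R) (fun=> 0)
       (fun i => d i * (i == j)%:R) (l j) x).
Proof.
apply: is_derive_line; rewrite /expcos.
have dD (f g : R -> R) (df dg : R) :
    is_derive (0 : R) (1 : R) f df -> is_derive (0 : R) (1 : R) g dg ->
    is_derive (0 : R) (1 : R) (fun t => f t + g t) (df + dg) by exact: is_deriveD.
have dM (f g : R -> R) (df dg : R) :
    is_derive (0 : R) (1 : R) f df -> is_derive (0 : R) (1 : R) g dg ->
    is_derive (0 : R) (1 : R) (fun t => f t * g t) (f 0 * dg + g 0 * df)
  by exact: is_deriveM.
have dZ (c : R) (f : R -> R) (df : R) : is_derive (0 : R) (1 : R) f df ->
    is_derive (0 : R) (1 : R) (fun t => c * f t) (c * df) by exact: is_deriveZ.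
have dx i : is_derive (0 : R) (1 : R)
    (fun t : R => (t *: delta_mx 0 j + x : 'rV[R]_m) 0 i) (i == j)%:R.
  have -> : (fun t : R => (t *: delta_mx 0 j + x : 'rV[R]_m) 0 i) =
      (fun t => (i == j)%:R * t + x 0 i).
    by apply/funext => t; rewrite !mxE /= mulrC.
  apply: is_derive_eq.
  by rewrite addr0 mulr1.
have dc (g : R -> R) i dg : (forall y, is_derive y (1 : R) g (dg y)) ->
    is_derive (0 : R) (1 : R) (fun t => g ((t *: delta_mx 0 j + x : 'rV[R]_m) 0 i))
      (dg (x 0 i) * (i == j)%:R).
  move=> gE; have := @is_derive1_comp _ g _ 0 _ _ (gE _) (dx i).
  by rewrite scale0r add0r.
have dsum (F : 'I_m -> R -> R) (dF : 'I_m -> R) :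
    (forall i, is_derive (0 : R) (1 : R) (F i) (dF i)) ->
    is_derive (0 : R) (1 : R) (fun t => \sum_i F i t) (\sum_i dF i).
  move=> FE; have -> : (fun t => \sum_i F i t) = \sum_i F i.
    by apply/funext => t; rewrite fct_sumE.
  exact: is_derive_sum.
have dquad i : is_derive (0 : R) (1 : R)
    (fun t => d i / 2 * (t *: delta_mx 0 j + x : 'rV[R]_m) 0 i ^+ 2
              + l i * (t *: delta_mx 0 j + x : 'rV[R]_m) 0 i) _ :=
  dD _ _ _ _ (dZ _ _ _ (dM _ _ _ _ (dx i) (dx i))) (dZ _ _ _ (dx i)).
have dtrig := dD _ _ _ _ (dZ p _ _ (dc _ b _ (@is_derive_cos R)))
                         (dZ q _ _ (dc _ b _ (@is_derive_sin R))).
have dexp := dM _ _ _ _ (dc _ a _ (@is_derive_expR R)) dtrig.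
have dall := dD _ _ _ _ (dD _ _ _ _ dexp (dsum _ _ dquad))
                        (is_derive_cst k (0 : R) (1 : R)).
apply: (is_derive_eq dall).
rewrite scale0r add0r addr0 -[RHS]addrA; congr (_ + _); first by ring.
rewrite big_split /= addrC [RHS]addrC; congr (_ + _).
  rewrite (bigD1 j) //= eqxx mulr1 big1 ?addr0 // => i /negPf ->.
  by rewrite mulr0.
by apply: eq_bigr => i _; field.
Qed.

Lemma continuous_expcos a b p q d l k : continuous (expcos a b p q d l k).
Proof.
move=> x.
have cc i : {for x, continuous (fun x : 'rV[R]_m => x 0 i)} by exact: coord_continuous.
have cM (f g : 'rV[R]_m -> R) : {for x, continuous f} -> {for x, continuous g} ->
    {for x, continuous (fun y => f y * g y)}
  by exact: continuousM.
have cD (f g : 'rV[R]_m -> R) : {for x, continuous f} -> {for x, continuous g} ->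
    {for x, continuous (fun y => f y + g y)}
  by exact: continuousD.
have cK (c : R) : {for x, continuous (fun _ : 'rV[R]_m => c)}.
  exact: cst_continuous.
rewrite /expcos; apply: (cD _ _ _ (cK _)); apply: (cD).
  apply: (cM); first by apply: (continuous_comp (cc a)); exact: continuous_expR.
  apply: (cD); apply: (cM) => //.
    by apply: (continuous_comp (cc b)); exact: continuous_cos.
  by apply: (continuous_comp (cc b)); exact: continuous_sin.
rewrite -fct_sumE; apply: (big_ind (fun g => {for x, continuous g})).
- exact: (cK 0).
- exact: (cD).
- move=> i _; have cii := cM _ _ (cc i) (cc i).
  exact: (cD _ _ (cM _ _ (cK _) cii) (cM _ _ (cK _) (cc i))).
Qed.

Lemma partial_expcos a b p q d l k j :
  partial j (expcos a b p q d l k) =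
    expcos a b (p * (a == j)%:R + q * (b == j)%:R)
      (q * (a == j)%:R - p * (b == j)%:R) (fun=> 0)
      (fun i => d i * (i == j)%:R) (l j).
Proof. by apply/funext => x; have [_ <-] := is_derive_expcos a b p q d l k j x. Qed.

Lemma C1_expcos a b p q d l k : C1 (expcos a b p q d l k).
Proof.
split; first exact: continuous_expcos.
- by move=> j x; have [] := is_derive_expcos a b p q d l k j x.
- by move=> j; rewrite partial_expcos; exact: continuous_expcos.
Qed.

Lemma C2_expcos a b p q d l k : C2 (expcos a b p q d l k).
Proof. by split=> [|j]; rewrite ?partial_expcos; exact: C1_expcos. Qed.

Lemma hessian_expcos a b p q d l k x : hessian (expcos a b p q d l k) x =
  \matrix_(i, j) (expR (x 0 a) *
    (((p * (a == j)%:R + q * (b == j)%:R) * (a == i)%:R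
      + (q * (a == j)%:R - p * (b == j)%:R) * (b == i)%:R) * cos (x 0 b)
     + ((q * (a == j)%:R - p * (b == j)%:R) * (a == i)%:R
      - (p * (a == j)%:R + q * (b == j)%:R) * (b == i)%:R) * sin (x 0 b))
    + d i * (i == j)%:R).
Proof.
apply/matrixP => i j; rewrite !mxE !partial_expcos /expcos big1 ?addr0 // => s _.
by rewrite !mul0r addr0.
Qed.

(** Substituting ['X] for the variable [b] and 0 for the others leaves a univariate polynomial. *)
Lemma polynomial_function_line f b : polynomial_function f ->
  exists q : {poly R}, forall t, f (t *: delta_mx 0 b) = q.[t].
Proof.
move=> [p pE]; exists (mpoly.mmap polyC (fun i => if i == b then 'X else 0) p).
move=> t; rewrite pE /mpoly.meval /mpoly.mmap horner_sum; apply: eq_bigr => s _.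
rewrite hornerM hornerC /mpoly.mmap1 horner_prod; congr (_ * _).
apply: eq_bigr => i _; rewrite horner_exp !mxE eqxx /=; case: eqP => _.
  by rewrite mulr1 hornerX.
by rewrite mulr0 horner0.
Qed.

Lemma cos_not_polynomial (q : {poly R}) : ~ cos =1 horner q.
Proof.
move=> qE.
have cosk k : cos (k%:R * (pi *+ 2) : R) = 1.
  elim: k => [|k IH]; first by rewrite mul0r cos0.
  by rewrite -natr1 mulrDl mul1r cosD2pi.
(* Otherwise [q - 1] would have as many distinct roots as its size, one more than its degree. *)
have q1 : q - 1 = 0.
  apply/eqP; apply: contraT => qN.
  have := max_poly_roots qN (rs := [seq k%:R * (pi *+ 2) | k <- iota 0 (size (q - 1))]).
  rewrite size_map size_iota ltnn; apply.
    by apply/allP => _ /mapP [k _ ->]; rewrite /root !hornerE -qE cosk subrr.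
  have pi2N : pi *+ 2 != 0 :> R by rewrite mulrn_eq0 /= gt_eqF ?pi_gt0.
  rewrite map_inj_uniq ?iota_uniq // => i j /(mulIf pi2N) /eqP.
  by rewrite eqr_nat => /eqP.
(* So [q] is constantly 1, while [cos pi] is -1. *)
have := qE pi; rewrite cospi; move/eqP: q1; rewrite subr_eq0 => /eqP ->.
rewrite hornerE; lra.
Qed.

Lemma expcos_not_polynomial a b p d l k : p != 0 -> a != b ->
  ~ polynomial_function (expcos a b p 0 d l k).
Proof.
move=> pN ab /(@polynomial_function_line _ b) [q qE].
(* On the [b] axis the exponential is 1, because [a != b]; removing the quadratic part and dividing
   by [p] isolates [cos]. *)
apply: (@cos_not_polynomial (p^-1 *: (q - ((d b / 2) *: 'X^2 + l b *: 'X + k%:P)))).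
move=> t; rewrite !hornerE -qE /expcos (bigD1 b) //= big1 => [|i /negPf ib].
  rewrite !mxE !eqxx (negPf ab) /= !(mulr0, mulr1) expR0.
  by field.
by rewrite !mxE ib andbF !(mulr0, expr0n) addr0.
Qed.

End ExpCos.

(** * The phase equation and lists of eigenvalues *)

Section Phase.
Context {R : realType}.
Implicit Types s : seq R.

Lemma prod_1Di s :
  \prod_(l <- s) (1 +i* l) = \sum_(k < (size s).+1) 'i ^+ k * (elem_sym k s)%:C.
Proof.
pose p := \prod_(l <- s) ('X - l%:P).
(* 1 + i l = - i (i - l), so the product is (- i)^n p(i), expanded by Viete. *)
have iNi : - 'i * 'i = 1 :> R[i] by rewrite mulNr -expr2 sqr_i opprK.
have -> : \prod_(l <- s) (1 +i* l) =
    (- 'i) ^+ size s * (map_poly (real_complex R) p).['i].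
  have -> : (- 'i) ^+ size s = \prod_(l <- s) - 'i :> R[i].
    by rewrite big_const_seq count_predT iter_mulr_1.
  rewrite rmorph_prod horner_prod -big_split /=.
  apply: eq_bigr => l _.
  by rewrite rmorphB /= map_polyX map_polyC /= !hornerE mulrBr iNi; simpc.
rewrite horner_coef size_map_poly size_prod_XsubC mulr_sumr.
(* Viete puts [elem_sym k s] in degree [size s - k], hence the reversed index. *)
rewrite (reindex_inj rev_ord_inj); apply: eq_bigr => k _ /=.
have kn : (k <= size s)%N by rewrite -ltnS.
rewrite subSS coef_map /= (mpoly.mroots_coeff (in_tuple s) k).
rewrite rmorphM rmorphXn rmorphN1 /=.
rewrite -/(elem_sym k s) -(mulrA _ _%:C) [_%:C * _]mulrC !mulrA; congr (_ * _).
rewrite -[X in (- 'i) ^+ X](subnK kn) exprD.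
have -> : (- 'i) ^+ (size s - k) * (- 'i) ^+ k * (-1) ^+ k * 'i ^+ (size s - k) =
    (- 'i * 'i) ^+ (size s - k) * (- 'i * -1) ^+ k :> R[i].
  by rewrite !exprMn; ring.
by rewrite iNi expr1n mul1r mulrN1 opprK.
Qed.

Lemma expr_i k : ('i : R[i]) ^+ k =
  if odd k then 0 +i* (-1) ^+ k./2 else ((-1) ^+ k./2)%:C.
Proof.
rewrite -{1}(odd_double_half k) exprD -mul2n exprM sqr_i.
have -> : (-1 : R[i]) ^+ k./2 = ((-1) ^+ k./2)%:C by rewrite rmorphXn rmorphN1.
by case: odd; rewrite ?expr0 ?expr1 ?mul1r //; simpc.
Qed.

(** Since 1 + i l = e^(i atan l) / cos (atan l), the arguments add up and [r] is the product of the
    1 / cos (atan l). *)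
Lemma prod_1Di_polar s : exists r : R,
  \prod_(l <- s) (1 +i* l) = (r * cos (phase s)) +i* (r * sin (phase s)).
Proof.
rewrite /phase; elim: s => [|l s [r IH]].
  by exists 1; rewrite !big_nil cos0 sin0 mulr1 mulr0.
exists (r / cos (atan l)); rewrite !big_cons IH cosD sinD.
have cN : cos (atan l) != 0.
  by rewrite cos_atan invr_neq0 // sqrtr_eq0 -ltNge ltr_pwDl ?sqr_ge0.
have lE : l = sin (atan l) / cos (atan l) by rewrite -[LHS]atanK.
rewrite {1}lE; move: (cos (atan l)) (sin (atan l)) cN => c t cN.
by simpc; apply/eqP; rewrite eq_complex /=; apply/andP; split; apply/eqP; field.
Qed.

Lemma phase_equation_phase s : phase_equation (phase s) s.
Proof.
have [r] := prod_1Di_polar s; rewrite prod_1Di /phase_equation.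
set A := \sum_(k < _ | odd k) _; set B := \sum_(k < _ | ~~ odd k) _.
have -> : \sum_(k < (size s).+1) 'i ^+ k * (elem_sym k s)%:C = B +i* A.
  rewrite (bigID (fun k : 'I_(size s).+1 => odd k)) /= addrC.
  transitivity (B%:C + 'i * A%:C); last by simpc.
  congr (_ + _).
    by rewrite rmorph_sum; apply: eq_bigr => k /negPf kN; rewrite expr_i kN rmorphM.
  rewrite rmorph_sum mulr_sumr; apply: eq_bigr => k kO; rewrite expr_i kO; by simpc.
(* Now [B] is r cos t and [A] is r sin t, so the two terms of the equation cancel. *)
by case=> -> ->; ring.
Qed.

Lemma phase_perm s t : perm_eq s t -> phase s = phase t.
Proof. by move=> st; exact: perm_big. Qed.

(** A monic split polynomial determines its roots up to order, which is all that the phase depends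
    on. *)
Lemma eigenvalues_perm {m : nat} (A : 'M[R[i]]_m) s :
  char_poly A = \prod_(l <- s) ('X - (l%:C)%:P) -> perm_eq (eigenvalues A) s.
Proof.
rewrite /eigenvalues => AE; case: closed_field_poly_normal => r /= rE.
have -> : s = [seq complex.Re l | l <- [seq l%:C | l <- s]].
  by rewrite -map_comp map_id_in.
apply: perm_map; apply: prod_XsubC_eq; rewrite big_map -AE [RHS]rE.
by rewrite (monicP (char_poly_monic A)) scale1r.
Qed.

Lemma phase_eigenvalues {m : nat} (A : 'M[R[i]]_m) s :
  char_poly A = \prod_(l <- s) ('X - (l%:C)%:P) -> phase (eigenvalues A) = phase s.
Proof. by move=> /eigenvalues_perm /phase_perm. Qed.

End Phase.

(** * The complex Hessian in real coordinates *)

Section ComplexHessian.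
Context {R : realType} {m : nat}.

Lemma to_complexK : cancel (@to_complex R m) (@real_coords R m).
Proof.
move=> p; rewrite -[RHS]hsubmxK /real_coords.
by congr row_mx; apply/rowP => i; rewrite !mxE.
Qed.

(** The arithmetic of [d_z] after [d_zbar]: [a], [b] are the x_j-derivatives and [c], [d] the
    y_j-derivatives of u_(x_k), u_(y_k). *)
Lemma wirtinger_halves (a b c d : R) :
  2^-1 * ((2^-1 * a) +i* (2^-1 * b) - 'i * ((2^-1 * c) +i* (2^-1 * d))) =
  ((a + d) / 4) +i* ((b - c) / 4) :> R[i].
Proof.
have -> : (2^-1 : R[i]) = (2^-1)%:C by rewrite fmorphV rmorph_nat.
by apply/eqP; rewrite eq_complex /=; apply/andP; split; apply/eqP; field.
Qed.

Lemma complex_hessian_real_coords (F : 'rV[R]_(m + m) -> R) z : C2 F ->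
  complex_hessian (F \o real_coords) z = \matrix_(j, k)
    let h := hessian F (real_coords z) in
    (((h (lshift m j) (lshift m k) + h (rshift m j) (rshift m k)) / 4)
     +i* ((h (lshift m j) (rshift m k) - h (rshift m j) (lshift m k)) / 4)).
Proof.
move=> [_ FC]; apply/matrixP => j k; rewrite !mxE.
(* [C2] makes the first partial derivatives derivable, so the factor 1/2 comes out. *)
have FdZ l l' x : partial l (fun p => 2^-1 * partial l' F p) x =
    2^-1 * partial l (partial l' F) x.
  by have [_ dF _] := FC l'; rewrite /partial deriveZ.
have zbE w : d_zbar k (fun w => ((F \o real_coords) w)%:C) w =
    (2^-1 * partial (lshift m k) F (real_coords w)) +i*
    (2^-1 * partial (rshift m k) F (real_coords w)).
  have pE l : cpartial l (fun w => ((F \o real_coords) w)%:C) w =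
      (partial l F (real_coords w))%:C.
    rewrite /cpartial /=; congr (_ +i* _); last exact: derive_cst.
    by congr (partial l _ _); apply/funext => p; rewrite to_complexK.
  rewrite /d_zbar !pE.
  have -> : (2^-1 : R[i]) = (2^-1)%:C by rewrite fmorphV rmorph_nat.
  by simpc.
have -> : d_zbar k (fun w => ((F \o real_coords) w)%:C) =
   (fun w => (2^-1 * partial (lshift m k) F (real_coords w)) +i*
    (2^-1 * partial (rshift m k) F (real_coords w))) by apply/funext.
have pE l l' : partial l (fun p => 2^-1 * partial l' F (real_coords (to_complex p)))
    (real_coords z) = 2^-1 * partial l (partial l' F) (real_coords z).
  under eq_fun do rewrite to_complexK.
  exact: FdZ.
have cE l : cpartial l (fun w => (2^-1 * partial (lshift m k) F (real_coords w)) +i*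
    (2^-1 * partial (rshift m k) F (real_coords w))) z =
    (2^-1 * partial l (partial (lshift m k) F) (real_coords z)) +i*
    (2^-1 * partial l (partial (rshift m k) F) (real_coords z)).
  by congr (_ +i* _); exact: pE.
by rewrite /d_z !cE wirtinger_halves /hessian /= !mxE.
Qed.

End ComplexHessian.

(** * Characteristic polynomials of special matrices *)

Section CharPoly.
Context {F : fieldType}.

Lemma char_poly_scalar {m : nat} (c : F) :
  char_poly (c%:M : 'M[F]_m) = \prod_(l <- nseq m c) ('X - l%:P).
Proof.
rewrite char_poly_trig ?scalar_mx_is_trig // big_nseq -[in RHS](card_ord m).
rewrite -big_const.
by apply: eq_bigr => i _; rewrite mxE eqxx.
Qed.

Lemma char_poly_block_diag {m1 m2 : nat} (A : 'M[F]_m1) (B : 'M[F]_m2) :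
  char_poly (block_mx A 0 0 B) = char_poly A * char_poly B.
Proof. by rewrite /char_poly char_block_diag_mx det_ublock. Qed.

Lemma char_poly_traceless2 (a b e : F) (A : 'M[F]_2) :
  A 0 0 = a -> A 1 1 = - a -> A 0 1 = b -> A 1 0 = b ->
  a ^+ 2 + b ^+ 2 = e ^+ 2 ->
  char_poly A = ('X - e%:P) * ('X - (- e)%:P).
Proof.
move=> A00 A11 A01 A10 abe.
rewrite /char_poly (expand_det_row _ 0) !big_ord_recl big_ord0.
rewrite /cofactor !det_mx11 !mxE /=.
have -> : lift (lift 0 0) 0 = 0 :> 'I_2 by apply: val_inj.
have -> : lift 0 (0 : 'I_1) = 1 :> 'I_2 by apply: val_inj.
rewrite A00 A11 A01 A10 /= rmorphN /= expr0 expr1 mulr1n mulr0n.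
have -> : ('X - e%:P) * ('X - (- e)%:P) = 'X ^+ 2 - (e ^+ 2)%:P :> {poly F}.
  by rewrite rmorphN rmorphXn /=; ring.
rewrite -abe rmorphD !rmorphXn /=; ring.
Qed.

End CharPoly.

(** * The two families of examples *)

Section Main.
Context {R : realType}.

Lemma phase_map_mx {m : nat} (A : 'M[R]_m) s :
  char_poly A = \prod_(l <- s) ('X - l%:P) ->
  phase (eigenvalues (map_mx (real_complex R) A)) = phase s.
Proof.
move=> AE; apply: phase_eigenvalues; rewrite -map_char_poly AE rmorph_prod.
by apply: eq_bigr => l _; rewrite rmorphB /= map_polyX map_polyC.
Qed.

(** The bound places [t / k%:R] strictly between -pi/2 and pi/2, where [atan] inverts [tan]. *)
Lemma atan_tan_div (t : R) (k : nat) : (0 < k)%N -> `|t| < k%:R * (pi / 2) ->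
  k%:R * atan (tan (t / k%:R)) = t.
Proof.
move=> k0 tk; have kp : 0 < k%:R :> R by rewrite ltr0n.
rewrite tanK; first by rewrite mulrC divfK ?gt_eqF.
by rewrite in_itv /= -ltr_norml normrM normfV (gtr0_norm kp) ltr_pdivrMr // mulrC.
Qed.

Lemma phase_nseq k (c : R) : phase (nseq k c) = k%:R * atan c.
Proof. by rewrite /phase big_nseq iter_addr_0 mulr_natl. Qed.

Lemma special_Lagrangian_example (k : nat) (t : R) :
  (0 < k)%N -> `|t| < k%:R * (pi / 2) ->
  exists f : 'rV[R]_(2 + k) -> R,
    [/\ entire_special_Lagrangian_solution f, ~ polynomial_function f
      & forall x, phase (real_eigenvalues f x) = t].
Proof.
move=> k0 tk; pose c := tan (t / k%:R).
pose a : 'I_(2 + k) := lshift k 0; pose b : 'I_(2 + k) := lshift k 1.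
have ab : a != b by rewrite (inj_eq (@lshift_inj _ _)).
pose d i : R := if fintype.split (i : 'I_(2 + k)) is inr _ then c else 0.
pose f := expcos a b 1 0 d (fun=> 0) 0.
have fphase x : phase (real_eigenvalues f x) = t.
  rewrite -(atan_tan_div _ _ k0 tk) -/c -phase_nseq.
  (* Adding two opposite eigenvalues keeps the phase and completes the spectrum of the Hessian. *)
  have -> : phase (nseq k c) = phase [:: expR (x 0 a), - expR (x 0 a) & nseq k c].
    by rewrite /phase !big_cons atanN addNKr.
  apply: phase_map_mx; rewrite !big_cons mulrA -char_poly_scalar.
  have -> : hessian f x =
      block_mx (\matrix_(i, j) hessian f x (lshift k i) (lshift k j)) 0 0 c%:M.
    rewrite -[LHS]submxK; congr block_mx; apply/matrixP => i j.
    - by rewrite !mxE.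
    - rewrite /f hessian_expcos !mxE /a /b !eq_shift /=; ring.
    - rewrite /f hessian_expcos !mxE /a /b !eq_shift /=; ring.
    - rewrite /f hessian_expcos !mxE /a /b !eq_shift /d (unsplitK (inr i))
      /=; case: (i == j); rewrite ?mulr1n ?mulr0n; ring.
  rewrite char_poly_block_diag; congr (_ * _).
  (* The planar block is e^(x_a) times the matrix with rows (cos x_b, - sin x_b) and (- sin x_b, -
     cos x_b). *)
  apply: (@char_poly_traceless2 _ (expR (x 0 a) * cos (x 0 b))
    (- (expR (x 0 a) * sin (x 0 b))));
    last by rewrite sqrrN !exprMn -mulrDr cos2Dsin2 mulr1.
  1-4: rewrite mxE /f hessian_expcos !mxE /a /b !eq_shift /d.
  1-4: by rewrite (unsplitK (inl _)) /=; ring.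
exists f; split=> //.
- split; first exact: C2_expcos.
  by exists t => x; rewrite -(fphase x); exact: phase_equation_phase.
- by apply: expcos_not_polynomial => //; exact: oner_neq0.
Qed.

Lemma dHYM_example (m : nat) (t : R) : `|t| < m.+1%:R * (pi / 2) ->
  exists u : 'rV[R[i]]_m.+1 -> R,
    [/\ entire_dHYM_solution u, ~ polynomial_function (u \o to_complex)
      & forall z, phase (complex_eigenvalues u z) = t].
Proof.
move=> tk; pose c := tan (t / m.+1%:R).
pose a : 'I_(m.+1 + m.+1) := lshift m.+1 0; pose b : 'I_(m.+1 + m.+1) := rshift m.+1 0.
have ab : a != b by rewrite eq_lrshift.
(* With [2 * c], the quadratic part has u_xx = u_yy = 2c in each complex coordinate, and (u_xx +
   u_yy) / 4 is [c]. *)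
pose f := expcos a b 1 0 (fun=> 2 * c) (fun=> 0) 0.
have fK : (f \o real_coords) \o to_complex = f.
  by apply/funext => p /=; rewrite to_complexK.
have fphase z : phase (complex_eigenvalues (f \o real_coords) z) = t.
  rewrite -(atan_tan_div _ _ (ltn0Sn m) tk) -/c -phase_nseq.
  apply: phase_eigenvalues.
  rewrite -(big_map (real_complex R) xpredT (fun l => 'X - l%:P)) map_nseq.
  rewrite -char_poly_scalar; congr char_poly.
  rewrite complex_hessian_real_coords; last exact: C2_expcos.
  (* The part e^x cos y drops out: its u_xx + u_yy vanishes, and its mixed derivatives agree. *)
  apply/matrixP => i j; rewrite /f hessian_expcos !mxE /a /b !eq_shift /=.
  case: (i == j); rewrite ?mulr1n ?mulr0n /=;
  by apply/eqP; rewrite eq_complex /=; apply/andP; split; apply/eqP; field.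
exists (f \o real_coords); split=> //.
- split; first by rewrite fK; exact: C2_expcos.
  by exists t => z; rewrite -(fphase z); exact: phase_equation_phase.
- by rewrite fK; apply: expcos_not_polynomial => //; exact: oner_neq0.
Qed.

End Main.

Theorem theorem1p3 (R : realType) (n : nat) (Theta : R)
    (hn : (3 <= n)%N) (hTheta : `|Theta| < (n%:R - 1) * (pi / 2)) :
  (exists u : 'rV[R[i]]_n.+1 -> R,
      [/\ entire_dHYM_solution u,
          ~ polynomial_function (u \o to_complex)
        & forall z, phase (complex_eigenvalues u z) = Theta]) /\
  (exists f : 'rV[R]_n.+1 -> R,
      [/\ entire_special_Lagrangian_solution f,
          ~ polynomial_function f
        & forall x, phase (real_eigenvalues f x) = Theta]).
Proof.
(* With n = k + 1 the bound is k pi/2 and the dimension is 2 + k; the complex example takes the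
   weaker bound (k + 2) pi/2. *)
case: n hn hTheta => // k hk; rewrite -natr1 addrK => hTheta; split.
  apply: dHYM_example; apply: lt_le_trans hTheta _.
  by rewrite ler_pM2r ?divr_gt0 ?pi_gt0 // ler_nat ltnW.
exact: special_Lagrangian_example (ltnW hk) hTheta.
Qed.
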